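(* Let $(X,Cn)$ be a consequence structure. If $Cn$ satisfies finiteness, then $Cn_{\mathbb{P}}$ also satisfies finiteness.
   Context: A consequence structure is a pair $(X,Cn)$ where $X$ is a set and $Cn:\wp(X)\to\wp(X)$ is an arbitrary function (no axioms imposed). A subset $A\subseteq X$ is $Cn$-consistent if $Cn(A)\neq X$. The operator $Cn_{\mathbb{P}}:\wp(X)\to\wp(X)$ is defined by $Cn_{\mathbb{P}}(A)=\bigcup\{Cn(A'):A'\subseteq A,\ A'\text{ is }Cn\text{-consistent}\}$. An operator $C:\wp(X)\to\wp(X)$ satisfies finiteness if for all $A\subseteq X$, $C(A)=\bigcup\{C(A'):A'\subseteq A,\ A'\text{ finite}\}$. *)

(* Defs.v *)
From mathcomp Require Import all_boot.
From mathcomp Require Import boolp classical_sets functions cardinality.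

Set Implicit Arguments.
Unset Strict Implicit.
Unset Printing Implicit Defensive.

Local Open Scope classical_set_scope.

(* A consequence structure (X, Cn) is a type X with an arbitrary operator
   Cn : set X -> set X, so the ambient set X is [set: X]. *)

Definition consistent (X : Type) (Cn : set X -> set X) (A : set X) : Prop :=
  Cn A <> [set: X].

Definition CnP (X : Type) (Cn : set X -> set X) (A : set X) : set X :=
  \bigcup_(A' in [set A' | A' `<=` A /\ consistent Cn A']) Cn A'.

Definition finiteness (X : Type) (C : set X -> set X) : Prop :=
  forall A : set X,
    C A = \bigcup_(A' in [set A' | A' `<=` A /\ finite_set A']) C A'.

(* Main.v *)
Require Import Defs.
From mathcomp Require Import all_boot.
From mathcomp Require Import boolp classical_sets functions cardinality.

(** Finiteness makes [Cn] monotone, so consistency passes to subsets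
    ([consistentS]).  If [x] lies in [Cn A'] with [A'] a consistent subset of
    [A], finiteness yields a finite [F] included in [A'] with [x] in [Cn F];
    this [F] is consistent, hence is its own witness that [x] belongs to
    [CnP Cn F].  The converse inclusion is the monotonicity of [CnP Cn]. *)

Local Open Scope classical_set_scope.

(** A finite subset of [A] is also a finite subset of any [B] above [A], so the
    union that computes [C B] has all the members of the one for [C A]. *)
Lemma finiteness_mono (X : Type) (C : set X -> set X) (A B : set X) :
  finiteness C -> A `<=` B -> C A `<=` C B.
Proof.
move=> finC AB; rewrite (finC A) (finC B) => x [F [FA finF] CFx].
by exists F => //; split=> //; exact: subset_trans AB.
Qed.

Lemma consistentS (X : Type) (Cn : set X -> set X) (A B : set X) :
  finiteness Cn -> A `<=` B -> consistent Cn B -> consistent Cn A.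
Proof.
move=> finCn AB consB CnAT; apply: consB.
by apply/seteqP; split=> //; rewrite -CnAT; exact: finiteness_mono.
Qed.

Lemma CnP_mono (X : Type) (Cn : set X -> set X) (A B : set X) :
  A `<=` B -> CnP Cn A `<=` CnP Cn B.
Proof.
move=> AB x [A' [A'A consA'] CnA'x].
by exists A' => //; split=> //; exact: subset_trans AB.
Qed.

Theorem proposition3p5 (X : Type) (Cn : set X -> set X) :
  finiteness Cn -> finiteness (CnP Cn).
Proof.
move=> finCn A; apply/seteqP; split=> x; last first.
  by case=> F [FA _]; exact: CnP_mono.
case=> A' [A'A consA']; rewrite (finCn A') => -[F [FA' finF] CnFx].
exists F; first by split=> //; exact: subset_trans A'A.
by exists F => //; split=> //; exact: consistentS consA'.
Qed.
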